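(* Let $L=a_4(x)D^4+a_3(x)D^3+a_2(x)D^2+a_1(x)D$ be a self-adjoint operator of order $4$, where $D=d/dx$, each $a_k$ is a real polynomial of degree at most $k$, and $a_4\not\equiv0$ is its leading term. If $a_4$ has more than one real root, then it has exactly two real roots, each with multiplicity $2$. Moreover, the multiplicity of each real root of $a_4$ in $a_3$ is $1$.
   Context: Self-adjointness is understood as follows. $I$ is an open interval whose finite endpoints are real zeros of $a_4$ and which contains no zero of $a_4$ (its endpoints are consecutive zeros of $a_4$, or $\pm\infty$). The weight is $p(x)=\frac{1}{|a_4(x)|}\exp\big(\frac12\int_{p_0}^x\frac{a_3(t)}{a_4(t)}dt\big)$ on $I$ ($p_0\in I$), and it is admissible: $\int_I p|u|\,dx<\infty$ for every polynomial $u$. $L$ is self-adjoint if $\int_I p\,(Ly)\,u\,dx=\int_I p\,y\,(Lu)\,dx$ for all $y,u\in C^\infty$, where $C^\infty$ is read as the space of real-valued infinitely differentiable functions on $I$ all of whose derivatives (including order $0$) are bounded on $I$ by polynomials. *)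

(* Defs.v *)
From HB Require Import structures.
From mathcomp Require Import all_boot all_order all_algebra.
From mathcomp Require Import all_classical all_reals all_analysis.

Set Implicit Arguments.
Unset Strict Implicit.
Unset Printing Implicit Defensive.

Import Order.TTheory GRing.Theory Num.Theory.
Import numFieldNormedType.Exports.

Local Open Scope classical_set_scope.
Local Open Scope ring_scope.

(* The endpoints are extended reals, so that the interval may be unbounded. *)
Definition open_interval (R : realType) (l r : \bar R) : set R :=
  [set x : R | (l < x%:E)%E /\ (x%:E < r)%E].

Definition endpoint (R : realType) (a4 : {poly R}) (e : \bar R) : Prop :=
  forall c : R, e = c%:E -> root a4 c.

Definition consecutive_zeros (R : realType) (a4 : {poly R}) (l r : \bar R) :
    Prop :=
  [/\ (l < r)%E, endpoint a4 l, endpoint a4 r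
    & forall x : R, open_interval l r x -> ~~ root a4 x].

(* The Lebesgue integral over a set, turned into the integral from a to b,
   with its sign when b < a. *)
Definition oriented_integral (R : realType) (a b : R) (f : R -> R) : R :=
  if a <= b then \int[@lebesgue_measure R]_(t in `[a, b]) f t
  else - \int[@lebesgue_measure R]_(t in `[b, a]) f t.

Definition weight (R : realType) (a3 a4 : {poly R}) (p0 x : R) : R :=
  `|a4.[x]|^-1 *
  expR (2^-1 * oriented_integral p0 x (fun t : R => a3.[t] / a4.[t])).

Definition admissible (R : realType) (I : set R) (p : R -> R) : Prop :=
  forall u : {poly R},
    (\int[@lebesgue_measure R]_(x in I) (p x * `|u.[x]|)%:E < +oo)%E.

(* A function on the open set I is represented by any extension to R: the
   values outside I do not affect the iterated derivatives at points of I. *)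
Definition smooth_poly_bounded (R : realType) (I : set R) (f : R -> R) : Prop :=
  forall n : nat,
    (forall x : R, I x -> derivable (derive1n n f) x 1) /\
    (exists q : {poly R}, forall x : R, I x -> `|derive1n n f x| <= q.[x]).

Definition diff_op (R : realType) (a1 a2 a3 a4 : {poly R}) (y : R -> R)
    (x : R) : R :=
  a4.[x] * derive1n 4 y x + a3.[x] * derive1n 3 y x
  + a2.[x] * derive1n 2 y x + a1.[x] * derive1n 1 y x.

(* Under admissibility both integrands are absolutely integrable, so these
   extended-real integrals are finite. *)
Definition self_adjoint (R : realType) (I : set R) (p : R -> R)
    (L : (R -> R) -> R -> R) : Prop :=
  forall y u : R -> R,
    smooth_poly_bounded I y -> smooth_poly_bounded I u ->
    (\int[@lebesgue_measure R]_(x in I) (p x * L y x * u x)%:E =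
     \int[@lebesgue_measure R]_(x in I) (p x * y x * L u x)%:E)%E.

(* Main.v *)
Require Import Defs.
From HB Require Import structures.
From mathcomp Require Import all_boot all_order all_algebra.
From mathcomp Require Import all_classical all_reals all_analysis.
From mathcomp Require Import measurable_realfun.
From mathcomp Require Import lra ring.

Set Implicit Arguments.
Unset Strict Implicit.
Unset Printing Implicit Defensive.

Import Order.TTheory GRing.Theory Num.Theory.
Import numFieldNormedType.Exports.

Local Open Scope classical_set_scope.
Local Open Scope ring_scope.

(** Write L as p L y = (A y'')'' + (B y')' + G y', where A = p a4, and
    B = p N / (4 a4) and G = p E / (8 a4^2) for polynomials N
    ([potential_numerator]) and E ([symmetry_defect]) in the coefficients. The
    shape of the weight says precisely that 2 A' = p a3, so A is, up to sign,
    the exponential e of half the primitive of a3 / a4.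
    Self-adjointness tested on the pairs (1, u), with u a polynomial, says that
    the integral of p L u over I vanishes.

    Behaviour of e at the ends of I. For every polynomial v the derivative
    (e v)' = +- p (2 a4 v' + a3 v) / 2 is integrable by admissibility, so e v
    has limits at both ends ([integrable_derive_end_limits]). These limits are
    0: at an infinite end because x e v has a limit too, at a finite end c
    because otherwise p = e / |a4| would dominate a multiple of 1 / |x - c|
    ([finite_end_factor_cvg0]). Hence the linear functional M w = int p w on
    polynomials kills every 2 a4 v' + a3 v ([moment_pearson]).

    The defect E vanishes. An algebraic identity ([defect_from_operator])
    expresses E t as a combination of L u and some 2 a4 v' + a3 v, so
    M (E t) = 0 for every polynomial t; with t = E, positivity of M gives
    E = 0 ([symmetry_defect_eq0]). This is a differential equation linking the
    four coefficients; at a root c of a4 it reads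
    a3(c) (a3(c) - 2 a4'(c)) (a3(c) - 4 a4'(c)) = 0.

    A finite end c of I is a multiple root of a4 ([finite_end_double_root]).
    If a4 had a simple root at c, then a3(c) = 2 j a4'(c) with j = 0, 1 or 2,
    and e / (x - c)^j would have a bounded logarithmic derivative near c, hence
    would stay away from 0. But it tends to 0: for j = 0 by the above, for
    j = 1, 2 because the boundary term A' w' + B w, whose derivative has
    integral 0, vanishes at the other end of I and so at c as well.

    I is bounded ([all_ends_finite]). Otherwise its finite end is a multiple
    root and the second root makes deg a4 >= 3. If deg a3 < deg a4, then e
    decays at most like a power of x at the infinite end, which is
    incompatible with e v -> 0 for all v. If deg a3 = deg a4 = 3, the leading
    term of N a3 in E = 0, of degree 9, cannot cancel.

    So both ends of I are multiple roots of a quartic, which leaves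
    a4 = k (x - c)^2 (x - d)^2. At a double root the equation above forces
    a3(c) = 0, and (x - c)^2 | a3 would make a3 / a4 bounded near c, so that e
    would not tend to 0; thus c is a simple root of a3
    ([finite_end_a3_simple_root]). *)

(** * Open intervals and their ends *)

Section OpenInterval.
Context {R : realType}.
Variables (l r : \bar R).
Local Notation I := (open_interval l r).
Local Notation mu := (@lebesgue_measure R).

Lemma open_interval_between a b x : I a -> I b -> a <= x <= b -> I x.
Proof.
move=> [la ar] [lb br] /andP[ax xb]; split.
- by apply: lt_le_trans la _; rewrite lee_fin.
- by apply: le_lt_trans br; rewrite lee_fin.
Qed.

Lemma open_interval_open : open I.
Proof. by apply: openI; [exact: open_ereal_gt|exact: open_ereal_lt]. Qed.

Lemma open_interval_measurable : measurable (I : set (measurableTypeR R)).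
Proof. exact: open_measurable open_interval_open. Qed.

Lemma open_interval_near x : I x -> \forall y \near x, I y.
Proof. by move=> Ix; apply: open_nbhs_nbhs; split=> //; exact: open_interval_open. Qed.

Lemma open_interval_sub a b : I a -> I b -> `[a, b] `<=` I.
Proof.
by move=> Ia Ib x /=; rewrite in_itv/=; exact: open_interval_between.
Qed.

(** The boolean selects an end of I, [true] the right one: this way every
    statement about an end is made once for both sides. *)
Definition beyond (b : bool) (t : R) : set R :=
  if b then [set x | t < x] else [set x | x < t].

(** Neighbourhoods of an end, described from inside I. This covers one-sided
    limits at a finite end and limits at infinity by the same filter. *)
Definition end_filter (b : bool) : set_system R :=
  [set P | exists2 t, I t & forall x, I x -> beyond b t x -> P x].

Lemma beyond_exists b t : I t -> exists2 x, I x & beyond b t x.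
Proof.
move=> It; have := open_interval_near It.
move=> /nbhs_ballP[d /= d0 dI]; case: b => /=.
- exists (t + d / 2); last by rewrite ltrDl divr_gt0.
  apply: dI; rewrite /ball/= opprD addrA subrr add0r normrN gtr0_norm ?divr_gt0//.
  by rewrite ltr_pdivrMr// ltr_pMr// ltr1n.
- exists (t - d / 2); last by rewrite ltrBlDr ltrDl divr_gt0.
  apply: dI; rewrite /ball/= opprB addrC subrK gtr0_norm ?divr_gt0//.
  by rewrite ltr_pdivrMr// ltr_pMr// ltr1n.
Qed.

Lemma beyond_trans b y x z : beyond b x y -> beyond b y z -> beyond b x z.
Proof. by case: b => /= xy yz; [exact: lt_trans xy yz|exact: lt_trans yz xy]. Qed.

Lemma beyond_asym b x y : beyond b x y -> ~ beyond b y x.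
Proof. by case: b => /= xy yx; have := lt_trans xy yx; rewrite ltxx. Qed.

Lemma beyond_join b t t' : I t -> I t' ->
  exists2 s, I s & forall x, beyond b s x -> beyond b t x /\ beyond b t' x.
Proof.
move=> It It'; case: b; have [tt'|t't] := leP t t'.
- by exists t' => // x /= t'x; split=> //; exact: le_lt_trans tt' t'x.
- by exists t => // x /= tx; split=> //; exact: lt_trans t't tx.
- by exists t => // x /= tx; split=> //; exact: lt_le_trans tx tt'.
- by exists t' => // x /= t'x; split=> //; exact: lt_trans t'x t't.
Qed.

Lemma end_filter_proper b p0 : I p0 -> ProperFilter (end_filter b).
Proof.
move=> Ip0; apply: Build_ProperFilter_ex.
  move=> P [t It Pt]; have [x Ix tx] := beyond_exists b It.
  by exists x; exact: Pt.
split.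
- by exists p0.
- move=> P Q [t It Pt] [t' It' Qt'].
  have [s Is st] := beyond_join b It It'.
  exists s => // x Ix /st[tx t'x].
  by split; [exact: Pt|exact: Qt'].
- by move=> P Q PQ [t It Pt]; exists t => // x Ix tx; apply: PQ; exact: Pt.
Qed.

Lemma end_filter_interval b p0 : I p0 -> end_filter b I.
Proof. by exists p0. Qed.

Lemma end_filter_beyond b t : I t -> end_filter b (beyond b t).
Proof. by exists t. Qed.

(** * Integrals and limits at the ends *)

Lemma is_derive_continuous (f : R -> R) (x df : R) :
  is_derive x 1 f df -> {for x, continuous f}.
Proof.
move=> fx; apply: differentiable_continuous; apply/derivable1_diffP.
exact: ex_derive.
Qed.

Lemma within_segment_continuous (f : R -> R) a b : I a -> I b ->
  (forall x, I x -> {for x, continuous f}) -> {within `[a, b], continuous f}.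
Proof.
move=> Ia Ib cf; apply: continuous_in_subspaceT => x.
by rewrite inE => abx; apply: cf; exact: open_interval_sub abx.
Qed.

Lemma segment_integrable (f : R -> R) a b : I a -> I b ->
  (forall x, I x -> {for x, continuous f}) ->
  mu.-integrable `[a, b] (EFin \o f).
Proof.
move=> Ia Ib cf; apply: continuous_compact_integrable.
  exact: segment_compact.
exact: within_segment_continuous.
Qed.

Lemma open_interval_measurable_fun (f : R -> R) :
  (forall x, I x -> {for x, continuous f}) -> measurable_fun I f.
Proof.
move=> cf; apply: open_continuous_measurable_fun; first exact: open_interval_open.
by move=> x; rewrite inE; exact: cf.
Qed.

(** The two orientations are glued by writing the integral as a difference of
    integrals from a base point a to the left of both bounds. *)
Lemma is_derive_oriented_integral (k : R -> R) p0 x : I p0 -> I x ->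
  (forall y, I y -> {for y, continuous k}) ->
  is_derive x 1 (fun y => oriented_integral p0 y k) (k x).
Proof.
move=> Ip0 Ix ck.
pose m := Num.min p0 x; pose M := Num.max p0 x.
have Im : I m by rewrite /m; case: ltP.
have IM : I M by rewrite /M; case: ltP.
have [a Ia /= am] := beyond_exists false Im.
have [u Iu /= Mu] := beyond_exists true IM.
move: am; rewrite lt_min => /andP[ap0 ax].
move: Mu; rewrite gt_max => /andP[p0u xu].
have iau : mu.-integrable `[a, u] (EFin \o k) by exact: segment_integrable.
have split_int y z : a <= y -> y <= z -> z <= u ->
    \int[mu]_(t in `[y, z]) k t =
    \int[mu]_(t in `[a, z]) k t - \int[mu]_(t in `[a, y]) k t.
  move=> ay yz zu.
  have iaz : mu.-integrable `[a, z] (EFin \o k).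
    apply: integrableS iau => //; apply: subset_itvl; by rewrite bnd_simp.
  rewrite Rintegral_itvB ?bnd_simp// Rintegral_itv_obnd_cbnd//.
  by apply: integrableS iaz => //; apply: subset_itvr; rewrite bnd_simp.
have [dF F'] := continuous_FTC1_closed xu iau ax (ck x Ix).
set F := (fun y => \int[mu]_(t in `[a, y]) k t) in dF F'.
have dF' : is_derive x 1 F (k x).
  by apply: DeriveDef => //; rewrite -derive1E.
have dG : is_derive x 1 (fun y => F y - F p0) (k x).
  have -> : k x = k x - 0 by rewrite subr0.
  exact: is_deriveB.
apply: near_eq_is_derive dG; near=> y.
have ay : a < y by near: y; exact: lt_nbhsr.
have yu : y < u by near: y; exact: lt_nbhsl.
rewrite /oriented_integral; case: leP => p0y.
- by rewrite -split_int// ltW.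
- by rewrite split_int ?opprB// ltW.
Unshelve. all: by end_near. Qed.

Lemma derive_ge0_homo (f df : R -> R) (a b : R) : a <= b ->
  (forall x, a <= x <= b -> is_derive x 1 f (df x)) ->
  (forall x, a <= x <= b -> 0 <= df x) -> f a <= f b.
Proof.
move=> ab f' df0.
have [||c] := @MVT_segment R f df a b ab.
- by move=> x; rewrite in_itv/= => /andP[ax xb]; apply: f'; rewrite !ltW.
- apply: continuous_in_subspaceT => x; rewrite inE/= in_itv/= => axb.
  exact: is_derive_continuous (f' x axb).
rewrite in_itv/= => acb fba; rewrite -subr_ge0 fba mulr_ge0 ?df0//.
by rewrite subr_ge0.
Qed.


Lemma segment_FTC (f h : R -> R) a b : I a -> I b -> a <= b ->
  (forall x, I x -> is_derive x 1 f (h x)) ->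
  (forall x, I x -> {for x, continuous h}) ->
  \int[mu]_(x in `[a, b]) h x = f b - f a.
Proof.
move=> Ia Ib; rewrite le_eqVlt => /predU1P[<- _ _|ab f' ch].
  by rewrite set_itv1 Rintegral_set1 subrr.
have cf x : I x -> {for x, continuous f}.
  by move=> Ix; exact: is_derive_continuous (f' x Ix).
rewrite /Rintegral (@continuous_FTC2 _ h f)//.
- exact: within_segment_continuous.
- split.
  + move=> x; rewrite in_itv/= => /andP[ax xb]; apply: ex_derive.
    by apply: f'; apply: (open_interval_between Ia Ib); rewrite !ltW.
  + exact: cvg_at_right_filter (cf a Ia).
  + exact: cvg_at_left_filter (cf b Ib).
- move=> x; rewrite in_itv/= => /andP[ax xb]; rewrite derive1E.
  apply: derive_val.
  by apply: f'; apply: (open_interval_between Ia Ib); rewrite !ltW.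
Qed.

(** A countable cofinal family at an end: it lets the dominated convergence
    theorem, stated for sequences, control the tails of integrals. *)
Lemma end_sequence b p0 : I p0 -> exists t : nat -> R,
  (forall n, I (t n)) /\ (forall x, I x -> \forall n \near \oo, beyond b x (t n)).
Proof.
case: b => -[lp pr].
- case: r pr => [c|_|//].
  + rewrite lte_fin => pc; have cp : 0 < c - p0 by rewrite subr_gt0.
    exists (fun n => c - (c - p0) / n.+1%:R); split=> [n|x [_]].
    * split; last by rewrite lte_fin ltrBlDr ltrDl divr_gt0.
      apply: lt_le_trans lp _; rewrite lee_fin lerBrDr -lerBrDl.
      by rewrite ler_pdivrMr// ler_pMr// ler1n.
    * rewrite lte_fin => xc; near=> n => /=.
      rewrite ltrBrDr -ltrBrDl ltr_pdivrMr// -ltr_pdivrMl ?subr_gt0//.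
      rewrite mulrC -natr1 ltr_pwDr//.
      by near: n; exact: nbhs_infty_ger.
  + exists (fun n => p0 + n%:R); split=> [n|x _].
    * split; last by rewrite ltry.
      by apply: lt_le_trans lp _; rewrite lee_fin lerDl.
    * near=> n => /=; rewrite -ltrBlDl; near: n; exact: nbhs_infty_gtr.
- case: l lp => [c|//|_].
  + rewrite lte_fin => pc; have cp : 0 < p0 - c by rewrite subr_gt0.
    exists (fun n => c + (p0 - c) / n.+1%:R); split=> [n|x []].
    * split; first by rewrite lte_fin ltrDl divr_gt0.
      apply: le_lt_trans pr; rewrite lee_fin -lerBrDl.
      by rewrite ler_pdivrMr// ler_pMr// ler1n.
    * rewrite lte_fin => xc _; near=> n => /=.
      rewrite -ltrBrDl ltr_pdivrMr// -ltr_pdivrMl ?subr_gt0//.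
      rewrite mulrC -natr1 ltr_pwDr//.
      by near: n; exact: nbhs_infty_ger.
  + exists (fun n => p0 - n%:R); split=> [n|x _].
    * split; first by rewrite ltNyr.
      by apply: le_lt_trans pr; rewrite lee_fin lerBlDr lerDl.
    * near=> n => /=; rewrite ltrBlDr -ltrBlDl; near: n; exact: nbhs_infty_gtr.
Unshelve. all: by end_near. Qed.

Lemma beyond_measurable b t : measurable (beyond b t : set (measurableTypeR R)).
Proof. by apply: open_measurable; case: b; [exact: open_gt|exact: open_lt]. Qed.

(** Dominated convergence for the restrictions of |h| to smaller and smaller
    neighbourhoods of the end. *)
Lemma tail_integral_small b p0 (h : R -> R) (eps : R) : I p0 -> 0 < eps ->
  mu.-integrable I (EFin \o h) ->
  exists2 t, I t & forall x, I x -> beyond b t x ->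
    `|\int[mu]_(y in I `&` beyond b x) h y| < eps.
Proof.
move=> Ip0 eps0 ih; have [t [It tend]] := end_sequence b Ip0.
have mI := open_interval_measurable.
have mB := beyond_measurable b.
have iah : mu.-integrable I (abse \o (EFin \o h)).
  exact/integrable_abse.
pose h_ n := (abse \o (EFin \o h)) \_ (beyond b (t n)).
have := @dominated_convergence _ _ R mu _ mI h_ (cst 0%E)
    (abse \o (EFin \o h)).

case => [n|||||_ _].
- apply/(measurable_restrict _ (mB _) mI); apply: measurable_funS (measurable_int mu iah)
  => //.
- done.
- apply: aeW => x Ix; apply: cvg_near_cst; near=> n.
  rewrite /h_ patchE memNset//.
  have : beyond b x (t n) by near: n; exact: tend.
  exact: beyond_asym.
- done.
- apply: aeW => x n Ix; rewrite /h_ patchE; case: ifPn => _ /=.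
    by rewrite normr_id.
  by rewrite normr0 lee_fin.
rewrite integral0 => h0.
have [n hn] : exists n, (\int[mu]_(x in I) h_ n x < eps%:E)%E.
  have /filter_ex[n hn] : \forall n \near \oo, (\int[mu]_(x in I) h_ n x < eps%:E)%E.
    apply: (h0 [set y | (y < eps%:E)%E]); apply: open_nbhs_nbhs.
    by split; [exact: open_ereal_lt_ereal|rewrite /= lte_fin].
  by exists n.
exists (t n) => // x Ix tx.
have mS y : measurable (I `&` beyond b y : set (measurableTypeR R)).
  exact: measurableI.
have ihS y : mu.-integrable (I `&` beyond b y) (EFin \o h).
  by apply: integrableS ih.
rewrite -lte_fin EFin_normr_Rintegral//.
apply: le_lt_trans (le_abse_integral _ _ _) _ => //.
  exact: measurable_int (ihS x).
apply: le_lt_trans hn; rewrite -integral_mkcondr.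
apply: ge0_subset_integral => //.
  exact/measurable_int/integrable_abse/ihS.
by move=> y [Iy xy]; split=> //; exact: beyond_trans tx xy.
Unshelve. all: by end_near. Qed.

Section IntegrableDerivative.
Variables (f h : R -> R).
Hypothesis f' : forall x, I x -> is_derive x 1 f (h x).
Hypothesis ch : forall x, I x -> {for x, continuous h}.
Hypothesis ih : mu.-integrable I (EFin \o h).

Let J b x := \int[mu]_(y in I `&` beyond b x) h y.

Let beyond_true_split x y : I x -> I y -> x < y ->
  I `&` beyond true x = `]x, y]%classic `|` (I `&` beyond true y).
Proof.
move=> Ix Iy xy; apply/seteqP; split=> z /=.
- move=> [Iz xz]; have [zy|yz] := leP z y; last by right.
  by left; rewrite in_itv/= xz zy.
- case=> [|[Iz yz]]; last by split=> //; exact: lt_trans yz.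
  rewrite in_itv/= => /andP[xz zy]; split=> //.
  by apply: (open_interval_between Ix Iy); rewrite ltW.
Qed.

Let beyond_false_split x y : I x -> I y -> x < y ->
  I `&` beyond false y = (I `&` beyond false x) `|` `[x, y[%classic.
Proof.
move=> Ix Iy xy; apply/seteqP; split=> z /=.
- move=> [Iz zy]; have [xz|zx] := leP x z; last by left.
  by right; rewrite in_itv/= xz zy.
- case=> [[Iz zx]|]; first by split=> //; exact: lt_trans xy.
  rewrite in_itv/= => /andP[xz zy]; split=> //.
  by apply: (open_interval_between Ix Iy); rewrite xz ltW.
Qed.

Let mIB b x : measurable (I `&` beyond b x : set (measurableTypeR R)).
Proof.
apply: measurableI; [exact: open_interval_measurable|exact: beyond_measurable].
Qed.

Let ihS (A : set (measurableTypeR R)) : measurable A -> A `<=` I ->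
  mu.-integrable A (EFin \o h).
Proof. by move=> mA AI; apply: integrableS ih => //; exact: open_interval_measurable. Qed.

Let tail_true x y : I x -> I y -> x < y -> f x + J true x = f y + J true y.
Proof.
move=> Ix Iy xy; rewrite /J (beyond_true_split Ix Iy xy) Rintegral_setU//.
- rewrite Rintegral_itv_obnd_cbnd; last first.
    apply: ihS => //; apply: subset_trans (open_interval_sub Ix Iy).
    exact: subset_itv_oc_cc.
  by rewrite (segment_FTC Ix Iy (ltW xy) f' ch); lra.
- rewrite -(beyond_true_split Ix Iy xy); apply: ihS; first exact: mIB.
  exact: subIsetl.
- apply/disj_setPS => z [/=]; rewrite in_itv/= => /andP[_ zy] [_ yz].
  by have := lt_le_trans yz zy; rewrite ltxx.
Qed.

Let tail_false x y : I x -> I y -> x < y -> f x - J false x = f y - J false y.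
Proof.
move=> Ix Iy xy; rewrite /J (beyond_false_split Ix Iy xy) Rintegral_setU//.
- rewrite Rintegral_itv_bndo_bndc; last first.
    apply: ihS => //; apply: subset_trans (open_interval_sub Ix Iy).
    exact: subset_itv_co_cc.
  by rewrite (segment_FTC Ix Iy (ltW xy) f' ch); lra.
- rewrite -(beyond_false_split Ix Iy xy); apply: ihS; first exact: mIB.
  exact: subIsetl.
- apply/disj_setPS => z [[_ /= zx]] /=; rewrite in_itv/= => /andP[xz _].
  by have := lt_le_trans zx xz; rewrite ltxx.
Qed.

(** The value of f at x plus (at the right end) or minus (at the left end) the
    tail of the integral of h beyond x does not depend on x, and the tails tend
    to 0: that constant is the limit of f. *)
Lemma integrable_derive_end_limits p0 : I p0 ->
  exists L : bool -> R, (forall b, f @ end_filter b --> L b) /\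
    \int[mu]_(x in I) h x = L true - L false.
Proof.
move=> Ip0.
exists (fun b => if b then f p0 + J true p0 else f p0 - J false p0); split.
- move=> b; have FF := end_filter_proper b Ip0.
  apply/cvgrPdist_lt => eps eps0.
  have [t It small] := tail_integral_small b Ip0 eps0 ih.
  exists t => // x Ix tx; have := small x Ix tx; rewrite -/(J b x).
  case: b {FF small} tx => /= tx.
  + suff -> : f p0 + J true p0 = f x + J true x by rewrite addrAC subrr add0r.
    have [p0x|xp0|->//] := ltgtP p0 x; first exact: tail_true.
    by apply/esym; exact: tail_true.
  + suff -> : f p0 - J false p0 = f x - J false x.
      by rewrite addrAC subrr add0r normrN.
    have [p0x|xp0|->//] := ltgtP p0 x; first exact: tail_false.
    by apply/esym; exact: tail_false.
- have Isplit : I = (I `&` beyond false p0) `|` ([set p0] `|` (I `&` beyond true p0)).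
    apply/seteqP; split=> [x Ix|x [[]//|[->//|[]//]]].
    have [xp0|p0x|->] := ltgtP x p0; [by left|by right; right|by right; left].
  have mU : measurable ([set p0] `|` (I `&` beyond true p0) : set (measurableTypeR R)).
    by apply: measurableU => //; exact: mIB.
  have iU : mu.-integrable ([set p0] `|` (I `&` beyond true p0)) (EFin \o h).
    by apply: ihS => // x [->//|[]].
  rewrite {1}Isplit Rintegral_setU//; last 2 first.
  + by rewrite -Isplit.
  + apply/disj_setPS => z [[_ /= zp0]] [/= zE|[_ /= p0z]].
      by move: zp0; rewrite zE ltxx.
    by have := lt_trans zp0 p0z; rewrite ltxx.
  rewrite Rintegral_setU//; last first.
  + by apply/disj_setPS => z [/= -> [_ /=]]; rewrite ltxx.
  by rewrite Rintegral_set1 -/(J true p0) -/(J false p0); lra.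
Qed.

End IntegrableDerivative.

End OpenInterval.


(** * Growth and decay at an end *)

Lemma cvg_eq_near {T : Type} {R : realType} {F : set_system T} {FF : Filter F}
    (f g : T -> R) (L : R) :
  (\forall x \near F, f x = g x) -> f @ F --> L -> g @ F --> L.
Proof.
move=> fg fL; apply: cvg_trans fL; apply: near_eq_cvg.
by apply: filterS fg.
Qed.

Section PointwiseRules.
Context {R : realType}.
Implicit Types (f g : R -> R) (x df dg : R).

Lemma is_derive_mul f g x df dg : is_derive x 1 f df -> is_derive x 1 g dg ->
  is_derive x 1 (fun y => f y * g y) (df * g x + f x * dg).
Proof.
move=> f' g'; apply: is_derive_eq (is_deriveM f' g') _.
by rewrite /GRing.scale/= addrC mulrC.
Qed.

Lemma is_derive_exprn f n x df : is_derive x 1 f df ->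
  is_derive x 1 (fun y => f y ^+ n) (n%:R * f x ^+ n.-1 * df).
Proof.
move=> f'; rewrite (_ : (fun y => f y ^+ n) = f ^+ n); first exact: is_deriveX.
by apply/funext => y; rewrite exprfctE.
Qed.

Lemma is_derive_subr c x : is_derive x 1 (fun y : R => y - c) 1.
Proof.
rewrite (_ : (fun y => _) = horner ('X - c%:P)); last first.
  by apply/funext => y; rewrite hornerXsubC.
by apply: is_derive_eq; rewrite derivXsubC hornerC.
Qed.

End PointwiseRules.

Section Ends.
Context {R : realType}.
Variables (l r : \bar R) (p0 : R).
Hypothesis Ip0 : open_interval l r p0.
Local Notation I := (open_interval l r).
Local Notation endf := (end_filter l r).

Definition end_point (b : bool) : \bar R := if b then r else l.

#[local] Instance end_filter_proper_ends b : ProperFilter (endf b).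
Proof. exact: end_filter_proper Ip0. Qed.

Lemma end_filter_near_interval b : \forall x \near endf b, I x.
Proof. exact: end_filter_interval Ip0. Qed.

Lemma cvg_to_finite_end b c : end_point b = c%:E -> id @ endf b --> c.
Proof.
case: (Ip0) => lp pr bc; apply/cvgrPdist_lt => e e0; case: b bc => /= bc.
- move: pr; rewrite bc lte_fin => p0c.
  exists (Num.max p0 (c - e)).
    split; first by apply: lt_le_trans lp _; rewrite lee_fin le_max lexx.
    by rewrite lte_fin gt_max p0c ltrBlDr ltrDl.
  move=> x [_] /=; rewrite lte_fin /= gt_max => xc /andP[_ cex].
  by rewrite ger0_norm ?subr_ge0 ?ltW// ltrBlDr -ltrBlDl.
- move: lp; rewrite bc lte_fin => cp0.
  exists (Num.min p0 (c + e)).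
    split; last by apply: le_lt_trans pr; rewrite lee_fin ge_min lexx.
    by rewrite lte_fin lt_min cp0 ltrDl.
  move=> x [] /=; rewrite lte_fin /= lt_min => cx _ /andP[_ xce].
  by rewrite ler0_norm ?subr_le0 ?ltW// opprB ltrBlDl.
Qed.

Lemma near_infinite_end b M : (forall c, end_point b <> c%:E) ->
  \forall x \near endf b, M < (-1) ^+ (~~ b) * x.
Proof.
case: (Ip0) => lp pr; case: b => /= binf.
- have rE : r = +oo%E by case: (r) pr binf => [c _ /(_ c)|//|//].
  exists (Num.max p0 M).
    split; first by apply: lt_le_trans lp _; rewrite lee_fin le_max lexx.
    by rewrite rE ltry.
  by move=> x _ /=; rewrite gt_max mul1r => /andP[].
- have lE : l = -oo%E by case: (l) lp binf => [c _ /(_ c)|//|//].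
  exists (Num.min p0 (- M)).
    split; last by apply: le_lt_trans pr; rewrite lee_fin ge_min lexx.
    by rewrite lE ltNyr.
  by move=> x _ /=; rewrite lt_min expr1 mulN1r ltrNr => /andP[].
Qed.

Lemma cvg_inv_infinite_end b k : (forall c, end_point b <> c%:E) ->
  (fun x => (x - k)^-1) @ endf b --> 0.
Proof.
move=> binf; apply/cvgrPdist_lt => e e0.
have := near_infinite_end (`|k| + e^-1) binf.
apply: filterS => x kex; rewrite sub0r normrN normfV.
have xk : e^-1 < `|x - k|.
  rewrite -ltrBrDl in kex; apply: lt_le_trans kex _.
  apply: le_trans (lerB_dist _ _); rewrite lerD2r.
  by apply: le_trans (ler_norm _) _; rewrite normrM normrX normrN1 expr1n mul1r.
by rewrite invf_plt ?posrE// (lt_trans _ xk)// invr_gt0.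
Qed.

Lemma cvg_horner_finite_end b c (v : {poly R}) : end_point b = c%:E ->
  horner v @ endf b --> v.[c].
Proof.
move=> bc; apply: (@cvg_comp _ _ _ id (horner v)) (cvg_to_finite_end bc) _.
exact: continuous_horner.
Qed.

(** The sign turns f into a function that increases towards the end, so its
    values stay above a positive one. *)
Lemma outward_growth_not_cvg0 b (f df : R -> R) :
  (forall x, I x -> is_derive x 1 f (df x)) ->
  (forall x, I x -> 0 < f x) ->
  (\forall x \near endf b, 0 <= (-1) ^+ (~~ b) * df x) ->
  ~ f @ endf b --> 0.
Proof.
move=> f' f0 [t It df0] fcvg; have [y Iy ty] := beyond_exists b It.
have [x [Ix yx fxy]] : exists x, [/\ I x, beyond b y x & f x < f y].
  have h1 : \forall x \near endf b, f x < f y by exact: (cvgr_lt _ fcvg _ (f0 y Iy)).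
  have h2 := end_filter_near_interval b.
  have h3 := end_filter_beyond b Iy.
  by have [x [? []]] := filter_ex (filterI h1 (filterI h2 h3)); exists x.
have homo : f y <= f x; last by have := le_lt_trans homo fxy; rewrite ltxx.
clear fcvg fxy; case: b df0 ty yx => /= df0 ty yx.
- apply: (@derive_ge0_homo R f df y x (ltW yx)) => z yzx.
    by apply: f'; exact: open_interval_between Iy Ix yzx.
  have := df0 z (open_interval_between Iy Ix yzx); rewrite mul1r; apply.
  by case/andP: yzx => yz _; exact: lt_le_trans ty yz.
- rewrite -lerN2; apply: (@derive_ge0_homo R (- f) (- df) x y (ltW yx)) => z xzy.
    by apply: is_deriveN; apply: f'; exact: open_interval_between Ix Iy xzy.
  have := df0 z (open_interval_between Ix Iy xzy); rewrite expr1 mulN1r; apply.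
  by case/andP: xzy => _ zy; exact: le_lt_trans zy ty.
Qed.

(** Multiplying f^2 by exp(2 K x), with |K| larger than |L| for the limit L of
    the logarithmic derivative q, makes it grow towards the end, and the exponential
    stays bounded because the end is finite. *)
Lemma log_derive_cvg_not_cvg0 b c (f q : R -> R) (L : R) :
  end_point b = c%:E ->
  (forall x, I x -> is_derive x 1 f (f x * q x)) ->
  (forall x, I x -> f x != 0) ->
  q @ endf b --> L -> ~ f @ endf b --> 0.
Proof.
move=> bc f' fneq0 qL f0.
(* the sign makes the exponential grow towards the chosen end *)
pose K : R := (-1) ^+ (~~ b) * (`|L| + 1).
pose g x := f x ^+ 2 * expR (K *+ 2 * x).
have g' x : I x -> is_derive x 1 g (g x * ((q x + K) *+ 2)).
  move=> Ix; have fx := f' x Ix.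
  have idx : is_derive x (1 : R) (fun y => K *+ 2 * y) (K *+ 2).
    have := is_deriveZ (K *+ 2) (is_derive_id x (1 : R)).
    by rewrite /GRing.scale /= mulr1.
  have ex : is_derive x (1 : R) (fun y => expR (K *+ 2 * y))
      (expR (K *+ 2 * x) * (K *+ 2)).
    by apply: is_derive_eq; rewrite /GRing.scale/=.
  apply: is_derive_eq.
  rewrite /GRing.scale /g /=.
  ring.
have g0 : g @ endf b --> 0.
  have -> : (0 : R) = 0 * 0 * expR (K *+ 2 * c) by rewrite !mul0r.
  apply: cvgM; first by apply: cvgM.
  apply: (@cvg_comp _ _ _ (fun x => K *+ 2 * x) expR _ (nbhs (K *+ 2 * c))).
    by apply: cvgMr; exact: cvg_to_finite_end.
  exact: continuous_expR.
apply: (outward_growth_not_cvg0 g' _ _ g0).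
- by move=> x Ix; rewrite mulr_gt0 ?expR_gt0// exprn_even_gt0//= fneq0.
- have h1 : \forall x \near endf b, `|L - q x| < 1.
    by move/cvgrPdist_lt : qL; apply.
  have h2 := end_filter_near_interval b.
  near=> x.
  have qx : `|L - q x| < 1 by near: x.
  have Ix : I x by near: x.
  have gx : 0 <= g x by rewrite mulr_ge0 ?expR_ge0// sqr_ge0.
  rewrite mulrCA mulr_ge0// mulrnAr mulrn_wge0// mulrDr mulrA -signr_addb addbb.
  rewrite mul1r.
  have L1 : - `|L| <= L by rewrite lerNl -normrN ler_norm.
  have L2 := ler_norm L.
  move: qx; rewrite ltr_norml => /andP[q1 q2].
  by case: (b); rewrite /= ?mul1r ?expr1 ?mulN1r; lra.
Unshelve. all: by end_near. Qed.

(** A function with logarithmic derivative O(1/x) decays at most like a power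
    of x: for N larger than |L|, L the limit of x q, the square of f (1 + x^2)^N grows
    towards the end. The base 1 + x^2, rather than x, keeps the product nonzero
    on all of I. *)
Lemma power_decay_infinite_end b (f q : R -> R) (L : R) :
  (forall c, end_point b <> c%:E) ->
  (forall x, I x -> is_derive x 1 f (f x * q x)) ->
  (forall x, I x -> f x != 0) ->
  (fun x => x * q x) @ endf b --> L ->
  exists v : {poly R}, ~ (fun x => f x * v.[x]) @ endf b --> 0.
Proof.
move=> binf f' fneq0 qL.
have [N LN] : exists N : nat, `|L| + 1 < N.+1%:R.
  exists (Num.bound (`|L| + 1)).
  have /lt_trans := @archi_boundP _ (`|L| + 1) (addr_ge0 (normr_ge0 _) ler01).
  by apply; rewrite ltr_nat.
exists ((1 + 'X^2) ^+ N.+1) => f0.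
pose m x : R := 1 + x ^+ 2.
have m0 x : 0 < m x by rewrite ltr_wpDr ?sqr_ge0.
pose g x := (f x * m x ^+ N.+1) ^+ 2.
pose d x := (q x + (N.+1%:R * x / m x) *+ 2) *+ 2.
have g' x : I x -> is_derive x 1 g (g x * d x).
  move=> Ix; have fx := f' x Ix.
  have mx : is_derive x (1 : R) m (x *+ 2).
    have ix := is_derive_id x (1 : R).
    apply: is_derive_eq.
    by rewrite /GRing.scale/= add0r mul1r mulr1 mulr2n.
  apply: is_derive_eq.
    exact/is_derive_exprn/is_derive_mul/is_derive_exprn.
  rewrite /g /d /= (exprS (m x) N).
  move: (m x ^+ N) (N.+1%:R) => A B; field.
  by rewrite gt_eqF.
have g0 : g @ endf b --> 0.
  rewrite (_ : 0 = 0 * 0); last by rewrite mulr0.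
  have -> : g = (fun x => (f x * ((1 + 'X^2) ^+ N.+1).[x]) *
                          (f x * ((1 + 'X^2) ^+ N.+1).[x])).
    by apply/funext => x; rewrite /g /m expr2 !hornerE.
  exact: cvgM.
apply: (outward_growth_not_cvg0 g' _ _ g0).
- by move=> x Ix; rewrite /g exprn_even_gt0//= mulf_neq0// ?fneq0// expf_neq0// gt_eqF.
- have h1 : \forall x \near endf b, `|L - x * q x| < 1.
    by move/cvgrPdist_lt : qL; apply.
  have h2 := end_filter_near_interval b.
  have h3 := near_infinite_end 1 binf.
  near=> x.
  have qx : `|L - x * q x| < 1 by near: x.
  have Ix : I x by near: x.
  have x1 : 1 < (-1) ^+ (~~ b) * x by near: x.
  have gx : 0 <= g x by rewrite sqr_ge0.
  rewrite mulrCA mulr_ge0//.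
  have x2 : 1 < x ^+ 2.
    have -> : x ^+ 2 = ((-1) ^+ (~~ b) * x) ^+ 2 by rewrite exprMn sqrr_sign mul1r.
    by rewrite expr2; apply: (lt_trans x1); rewrite ltr_pMr// (lt_trans _ x1).
  have xn0 : x != 0 by apply: contraTneq x2 => ->; rewrite expr0n/= ltr10.
  have -> : (-1) ^+ (~~ b) * d x = ((-1) ^+ (~~ b) * x) * (x * d x) / x ^+ 2.
    by field.
  rewrite divr_ge0 ?sqr_ge0// mulr_ge0// ?(le_trans ler01 (ltW x1))//.
  have -> : x * d x = (x * q x + (N.+1%:R * (x ^+ 2 / m x)) *+ 2) *+ 2.
    by rewrite /d; ring.
  have xm : 2^-1 <= x ^+ 2 / m x.
    by rewrite ler_pdivlMr// /m; lra.
  have Nx : N.+1%:R * 2^-1 <= N.+1%:R * (x ^+ 2 / m x) by rewrite ler_wpM2l.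
  have L1 : - `|L| <= L by rewrite lerNl -normrN ler_norm.
  move: qx; rewrite ltr_norml => /andP[q1 q2].
  by rewrite mulrn_wge0//; lra.
Unshelve. all: by end_near. Qed.

Lemma cvg_coef_infinite_end b (f : {poly R}) n :
  (forall c, end_point b <> c%:E) -> (size f <= n.+1)%N ->
  (fun x => f.[x] / x ^+ n) @ endf b --> f`_n.
Proof.
move=> binf; have inv0 := cvg_inv_infinite_end 0 binf.
have {}inv0 : (fun x : R => x^-1) @ endf b --> 0.
  by under eq_fun do rewrite -[X in X^-1]subr0.
have pow0 k : (fun x : R => x^-1 ^+ k.+1) @ endf b --> 0.
  elim: k => [//|k IHk].
  under eq_fun do rewrite exprS.
  have -> : (0 : R) = 0 * 0 by rewrite mulr0.
  exact: cvgM inv0 IHk.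
have h3 := near_infinite_end 1 binf.
elim/poly_ind: f n => [n _|f c IH [|n]].
- rewrite coef0; under eq_fun do rewrite horner0 mul0r.
  exact: cvg_cst.
- rewrite size_MXaddC; case: ifP => [/andP[/eqP -> /eqP ->] _|_].
    rewrite mul0r addr0 coef0; under eq_fun do rewrite horner0 mul0r.
    exact: cvg_cst.
  rewrite ltnS leqn0 size_poly_eq0 => /eqP ->.
  rewrite mul0r add0r coefC/=; under eq_fun do rewrite hornerC expr0 divr1.
  exact: cvg_cst.
- move=> sf; have {sf}fn : (size f <= n.+1)%N.
    move: sf; rewrite size_MXaddC; case: ifP => [/andP[/eqP -> _]|_ //].
    by rewrite size_poly0.
  rewrite coefD coefC coefMX/= addr0.
  have lim : (fun x => f.[x] / x ^+ n + c * x^-1 ^+ n.+1) @ endf b --> f`_n.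
    rewrite -[X in _ --> X]addr0; apply: cvgD; first exact: IH.
    rewrite -[X in _ --> X](mulr0 c); apply: cvgMr.
    exact: pow0.
  apply: cvg_eq_near lim; near=> x.
  have x1 : 1 < (-1) ^+ (~~ b) * x by near: x.
  have xn0 : x != 0 by apply: contraTneq x1 => ->; rewrite mulr0 ltr10.
  rewrite hornerMXaddC exprVn exprS; field.
  by rewrite xn0 expf_neq0.
Unshelve. all: by end_near. Qed.

End Ends.


(** * The weight as a positive functional on polynomials *)

Lemma poly_zero_on_interval {R : realType} (l r : \bar R) (p0 : R) (w : {poly R}) :
  open_interval l r p0 -> (forall x, open_interval l r x -> w.[x] = 0) -> w = 0.
Proof.
move=> Ip0 w0; apply/eqP; apply: contraT => wneq0.
have [q Iq /= pq] := beyond_exists true Ip0.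
pose pt (n : nat) := p0 + (q - p0) / n.+1%:R.
have pt_inj : injective pt.
  move=> m n /addrI /mulfI mn; apply/eqP; rewrite -eqSS -(eqr_nat R); apply/eqP.
  by apply: invr_inj; apply: mn; rewrite subr_eq0 gt_eqF.
have pt_in n : open_interval l r (pt n).
  have pq0 : 0 < q - p0 by rewrite subr_gt0.
  apply: (open_interval_between Ip0 Iq); apply/andP; split.
    by rewrite lerDl divr_ge0// ltW.
  by rewrite /pt addrC -lerBrDr ler_pdivrMr// ler_pMr// ler1n.
have := @max_poly_roots _ w [seq pt i | i <- iota 0 (size w)] wneq0.
rewrite size_map size_iota ltnn => -> //.
- by apply/allP => _ /mapP[n _ ->]; apply/eqP/w0.
- by rewrite map_inj_uniq// iota_uniq.
Qed.

(** The coefficient in (e v)' = +- p (pearson v) / 2; a weight whose moments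
    kill all these polynomials satisfies a Pearson equation. *)
Definition pearson {K : nzRingType} (a3 a4 v : {poly K}) : {poly K} :=
  a4 * v^`() *+ 2 + a3 * v.

(** The weight p of the problem through its integrating factor e = |p a4|; the
    number s is the constant sign of a4 on I. *)
Record pearson_weight {R : realType} (l r : \bar R) (a3 a4 : {poly R})
    (e p : R -> R) (s : R) : Prop := PearsonWeightOf {
  pw_e_gt0 : forall x, open_interval l r x -> 0 < e x ;
  pw_derive : forall x, open_interval l r x ->
    is_derive x 1 e (e x * (a3.[x] / (2 * a4.[x]))) ;
  pw_sign : s * s = 1 ;
  pw_norm : forall x, open_interval l r x -> `|a4.[x]| = s * a4.[x] ;
  pw_neq0 : forall x, open_interval l r x -> a4.[x] != 0 ;
  pw_weightE : forall x, open_interval l r x -> p x = e x / `|a4.[x]| ;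
  pw_integrable : forall w : {poly R},
    (@lebesgue_measure R).-integrable (open_interval l r)
      (EFin \o (fun x => p x * w.[x]))
}.

Section PearsonWeight.
Context {R : realType}.
Variables (l r : \bar R) (p0 : R) (a3 a4 : {poly R}) (e p : R -> R) (s : R).
Local Notation I := (open_interval l r).
Local Notation endf := (end_filter l r).
Local Notation end_point := (end_point l r).
Local Notation mu := (@lebesgue_measure R).
Hypothesis Ip0 : I p0.
Hypothesis W : pearson_weight l r a3 a4 e p s.
Hypothesis endpoints : forall b c, end_point b = c%:E -> root a4 c.

Let e_gt0 := pw_e_gt0 W.
Let e' := pw_derive W.
Let s2 := pw_sign W.
Let a4_norm := pw_norm W.
Let a4_neq0 := pw_neq0 W.
Let pE := pw_weightE W.
Let ip := pw_integrable W.

#[local] Instance end_filter_proper_pearson b : ProperFilter (endf b).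
Proof. exact: end_filter_proper Ip0. Qed.

Definition moment (w : {poly R}) : R := \int[mu]_(x in I) (p x * w.[x]).

Local Notation pearson := (pearson a3 a4).

Lemma momentB u w : moment (u - w) = moment u - moment w.
Proof.
rewrite /moment -RintegralB//.
- by apply: eq_Rintegral => x _; rewrite hornerD hornerN mulrBr.
- exact: open_interval_measurable.
Qed.

Lemma momentZ k w : moment (k *: w) = k * moment w.
Proof.
rewrite /moment -RintegralZl//.
- by apply: eq_Rintegral => x _; rewrite hornerZ mulrCA.
- exact: open_interval_measurable.
Qed.

Lemma s_neq0 : s != 0.
Proof. by apply: contra_eq_neq s2 => ->; rewrite mulr0 eq_sym oner_eq0. Qed.

Lemma weight_gt0 x : I x -> 0 < p x.
Proof. by move=> Ix; rewrite pE// divr_gt0 ?e_gt0// normr_gt0 a4_neq0. Qed.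

Lemma factorE x : I x -> e x = s * p x * a4.[x].
Proof.
move=> Ix; rewrite pE// mulrAC -a4_norm// mulrC divfK//.
by rewrite normr_eq0 a4_neq0.
Qed.

Lemma weight_continuous x : I x -> {for x, continuous p}.
Proof.
move=> Ix.
have c : {for x, continuous (fun y => e y / (s * a4.[y]))}.
  apply: cvgM; first exact: is_derive_continuous (e' Ix).
  apply: cvgV; first by rewrite mulf_neq0 ?s_neq0// a4_neq0.
  by apply: cvgMr; exact: continuous_horner.
have Inear := open_interval_near Ix.
have pnear : \forall y \near x, e y / (s * a4.[y]) = p y.
  by apply: filterS Inear => y Iy; rewrite pE// a4_norm.
have pc : p @ x --> e x / (s * a4.[x]).
  exact: cvg_eq_near pnear c.
by rewrite (nbhs_singleton pnear) in pc.
Qed.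

Lemma weight_poly_continuous w x : I x -> {for x, continuous (fun y => p y * w.[y])}.
Proof.
move=> Ix; apply: cvgM; first exact: weight_continuous.
exact: continuous_horner.
Qed.

Lemma is_derive_flux v x : I x ->
  is_derive x 1 (fun y => e y * v.[y]) (p x * ((s / 2) *: pearson v).[x]).
Proof.
move=> Ix; apply: is_derive_eq; first exact: is_derive_mul (e' Ix) (is_derive_poly v x).
rewrite /pearson !(hornerZ, hornerD, hornerM, hornerMn) factorE//.
have := a4_neq0 Ix => a40.
field. 
by rewrite a40.
Qed.

Lemma flux_end_limits v : exists L : bool -> R,
  (forall b, (fun y => e y * v.[y]) @ endf b --> L b) /\
  s / 2 * moment (pearson v) = L true - L false.
Proof.
rewrite -momentZ.
have dv x : I x ->
    is_derive x 1 (fun y => e y * v.[y]) (p x * ((s / 2) *: pearson v).[x]).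
  exact: is_derive_flux.
have cv x : I x -> {for x, continuous (fun y => p y * ((s / 2) *: pearson v).[y])}.
  exact: weight_poly_continuous.
exact: (integrable_derive_end_limits dv cv (ip _) Ip0).
Qed.

Lemma infinite_end_flux0 b v : (forall c, end_point b <> c%:E) ->
  (fun y => e y * v.[y]) @ endf b --> 0.
Proof.
move=> binf; have [L [/(_ b) evX _]] := flux_end_limits (v * 'X).
have lim : (fun y => e y * (v * 'X).[y] * (y - 0)^-1) @ endf b --> L b * 0.
  exact: (cvgM evX (cvg_inv_infinite_end Ip0 0 binf)).
rewrite mulr0 in lim; apply: cvg_eq_near lim.
have xfar := near_infinite_end Ip0 1 binf; near=> x.
have x1 : 1 < (-1) ^+ (~~ b) * x by near: x.
have xn0 : x != 0 by apply: contraTneq x1 => ->; rewrite mulr0 ltr10.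
by rewrite /= hornerM hornerX subr0 mulrA mulfK.
Unshelve. all: by end_near. Qed.

(** If e had a limit L > 0 at c, then p = e / |a4| would be at least
    1 / (C |x - c|) near c. With Q a primitive of p, which converges at c by
    integrability, the function |x - c| exp(+- C Q) would then grow towards c,
    and yet tend to 0: this replaces the divergence of the logarithm. *)
Lemma finite_end_factor_cvg0 b c : end_point b = c%:E -> e @ endf b --> 0.
Proof.
move=> bc; have [L [/(_ b) eL _]] := flux_end_limits 1.
have {}eL : e @ endf b --> L b.
  by apply: cvg_eq_near eL; near=> y; rewrite hornerC mulr1.
suff L0 : L b = 0 by rewrite L0 in eL.
have nearI := end_filter_near_interval Ip0 b.
apply/eqP; rewrite eq_le; apply/andP; split; last first.
  rewrite leNgt; apply/negP => L0.
  have eneg : \forall y \near endf b, e y < 0 by exact: cvgr_lt eL _ L0.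
  have [y [ey Iy]] := filter_ex (filterI eneg nearI).
  by have := lt_trans ey (e_gt0 Iy); rewrite ltxx.
rewrite leNgt; apply/negP => L0.
have /factor_theorem[k a4E] := endpoints bc.
pose K : R := `|k.[c]| + 1; have K0 : 0 < K by rewrite ltr_wpDl.
(* near c one has e > L / 2 and |k| < K, hence C |x - c| p >= 1 *)
pose C : R := 2 * K / L b; have C0 : 0 < C by rewrite divr_gt0// mulr_gt0.
pose sg : R := (-1) ^+ (~~ b); have sg2 : sg * sg = 1 by rewrite -expr2 sqrr_sign.
have dist_gt0 x : I x -> 0 < sg * (c - x).
  rewrite /sg; case: (b) bc => /= -> [+ +]; rewrite !lte_fin.
  - by rewrite mul1r subr_gt0.
  - by rewrite expr1 mulN1r opprB subr_gt0.
have [Q [Q' [M QM]]] : exists Q : R -> R,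
    (forall x, I x -> is_derive x 1 Q (p x)) /\ exists M : R, Q @ endf b --> M.
  exists (fun x => oriented_integral p0 x p).
  have Q' x : I x -> is_derive x 1 (fun x => oriented_integral p0 x p) (p x).
    by move=> Ix; apply: (is_derive_oriented_integral Ip0 Ix); exact: weight_continuous.
  split=> //.
  have ip1 : mu.-integrable I (EFin \o p).
    have := ip 1; congr (integrable _ _ _); apply/funext => x /=.
    by rewrite hornerC mulr1.
  have [M [QM _]] := integrable_derive_end_limits Q' weight_continuous ip1 Ip0.
  by exists (M b).
pose f x := sg * (c - x) * expR (sg * C * Q x).
pose df x := expR (sg * C * Q x) * (- sg + sg * (c - x) * (sg * C * p x)).
have f' x : I x -> is_derive x 1 f (df x).
  move=> Ix; have Qx := Q' x Ix.
  have ex : is_derive x 1 (fun y => expR (sg * C * Q y)) 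
      (expR (sg * C * Q x) * (sg * C * p x)).
    by apply: is_derive_eq; rewrite /GRing.scale/=.
  have cx : is_derive x (1 : R) (fun y => sg * (c - y)) (- sg).
    rewrite (_ : (fun y => _) = horner (sg *: (c%:P - 'X))); last first.
      by apply/funext => y; rewrite hornerZ hornerD hornerN hornerC hornerX.
    apply: is_derive_eq.
    by rewrite derivZ derivB derivC derivX hornerZ sub0r hornerN hornerC mulrN1.
  apply: (is_derive_eq (is_derive_mul cx ex)).
  by rewrite /df; ring.
have f0 : f @ endf b --> 0.
  have -> : (0 : R) = sg * (c - c) * expR (sg * C * M) by rewrite subrr mulr0 mul0r.
  apply: cvgM.
    apply: cvgMr; apply: cvgB; first exact: cvg_cst.
    exact: (cvg_to_finite_end Ip0 bc).
  apply: (@cvg_comp _ _ _ (fun x => sg * C * Q x) expR _ (nbhs (sg * C * M))).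
    exact: cvgMr.
  exact: continuous_expR.
apply: (outward_growth_not_cvg0 Ip0 f' _ _ f0).
  by move=> x Ix; rewrite mulr_gt0 ?expR_gt0// dist_gt0.
have h1 : \forall y \near endf b, L b / 2 < e y.
  by apply: cvgr_gt eL _ _; rewrite ltr_pdivrMr// ltr_pMr// ltr1n.
have h2 : \forall y \near endf b, `|k.[c] - k.[y]| < 1.
  by have /cvgrPdist_lt := cvg_horner_finite_end (v := k) Ip0 bc; apply.
near=> x.
have Ix : I x by near: x.
have ex : L b / 2 < e x by near: x.
have kx : `|k.[x]| < K.
  have : `|k.[c] - k.[x]| < 1 by near: x.
  rewrite distrC => kx; rewrite -(subrK k.[c] k.[x]).
  by apply: le_lt_trans (ler_normD _ _) _; rewrite /K addrC ltrD2l.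
rewrite -/sg /df mulrCA mulr_ge0 ?expR_ge0//.
have px : sg * (c - x) * p x = e x / `|k.[x]|.
  have sgx : `|a4.[x]| = `|k.[x]| * (sg * (c - x)).
    rewrite a4E hornerM hornerXsubC normrM; congr (_ * _).
    by rewrite -(gtr0_norm (dist_gt0 x Ix)) normrM distrC /sg normr_sign mul1r.
  have := dist_gt0 x Ix; rewrite pE// sgx.
  have k0 : `|k.[x]| != 0.
    by have := a4_neq0 Ix; rewrite -normr_eq0 sgx mulf_eq0 negb_or => /andP[].
  move: k0; move: (sg * (c - x)) `|k.[x]| (e x) => D k' e1 k0 D0.
  by field; rewrite k0/= gt_eqF.
have -> : sg * (- sg + sg * (c - x) * (sg * C * p x)) =
  sg * sg * (C * (sg * (c - x) * p x) - 1) by ring.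
rewrite px sg2 mul1r subr_ge0.
have k0 : 0 < `|k.[x]|.
  by rewrite normr_gt0; have := a4_neq0 Ix; rewrite a4E hornerM mulf_eq0 negb_or => /andP[].
rewrite /C mulrA ler_pdivlMr// mul1r mulrAC ler_pdivlMr//.
have : `|k.[x]| * L b <= K * L b by rewrite ler_wpM2r// ltW.
have : K * (L b / 2) <= K * e x by rewrite ler_wpM2l// ltW.
by lra.
Unshelve. all: by end_near. Qed.

(** At a finite end the limit is that of e times v(c); at an infinite one it is
    the limit of e x v divided by x. *)
Lemma flux_cvg0 b v : (fun y => e y * v.[y]) @ endf b --> 0.
Proof.
case bE : (end_point b) => [c||]; try by apply: infinite_end_flux0 => c; rewrite bE.
rewrite -(mul0r v.[c]); apply: cvgM; first exact: finite_end_factor_cvg0 bE.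
exact: (cvg_horner_finite_end Ip0 bE).
Qed.

Lemma moment_pearson v : moment (pearson v) = 0.
Proof.
have [L [evL eq]] := flux_end_limits v.
have L0 b : L b = 0.
  exact: (cvg_unique (@Rhausdorff R) (evL b) (flux_cvg0 b v)).
move/eqP : eq; rewrite !L0 subrr !mulf_eq0 invr_eq0 pnatr_eq0 (negbTE s_neq0).
by move=> /eqP.
Qed.

(** The integrals of p w^2 over segments are squeezed to 0, and p w^2 is the
    derivative of such integrals. *)
Lemma moment_square_eq0 w : moment (w * w) = 0 -> w = 0.
Proof.
move=> m0; apply: (poly_zero_on_interval Ip0) => x Ix.
have cw y (Iy : I y) := weight_poly_continuous (w := w * w) Iy.
have pw0 y : I y -> 0 <= p y * (w * w).[y].
  by move=> Iy; rewrite mulr_ge0 ?(ltW (weight_gt0 Iy))// hornerM -expr2 sqr_ge0.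
have int0 : (\int[mu]_(y in I) (p y * (w * w).[y])%:E = 0)%E.
  have fin := integrable_fin_num (open_interval_measurable l r) (ip (w * w)).
  by rewrite -(fineK fin) [X in X%:E]m0.
have seg0 a b : I a -> I b -> \int[mu]_(y in `[a, b]) (p y * (w * w).[y]) = 0.
  move=> Ia Ib; rewrite /Rintegral.
  suff -> : (\int[mu]_(y in `[a, b]) (p y * (w * w).[y])%:E = 0)%E by [].
  have sub := open_interval_sub Ia Ib.
  apply/eqP; rewrite eq_le; apply/andP; split.
  - rewrite -int0; apply: ge0_subset_integral => //.
    + exact: open_interval_measurable.
    + exact: measurable_int (ip _).
  - by apply: integral_ge0 => y /sub Iy; rewrite lee_fin pw0.
have F' := is_derive_oriented_integral Ip0 Ix cw.
have F0 : is_derive x 1 (fun y => oriented_integral p0 y (fun y => p y * (w * w).[y])) 0.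
  apply: near_eq_is_derive (is_derive_cst 0 x 1).
  apply: filterS (open_interval_near Ix) => y Iy.
  by rewrite /oriented_integral !seg0// oppr0; case: ifP.
have := @derive_val _ _ _ _ _ _ _ F'; rewrite (@derive_val _ _ _ _ _ _ _ F0) => /esym/eqP.
by rewrite mulf_eq0 (gt_eqF (weight_gt0 Ix))/= hornerM mulf_eq0 orbb => /eqP.
Qed.

End PearsonWeight.


(** * The equation linking the coefficients *)

Section Algebra.
Context {K : comNzRingType}.
Variables (a1 a2 a3 a4 : {poly K}).

(** L u as a function of w = u'. *)
Definition operator_on_derivative (w : {poly K}) : {poly K} :=
  a4 * w^`()^`()^`() + a3 * w^`()^`() + a2 * w^`() + a1 * w.

(** With A = p a4, this is 4 a4 / p times B = p a2 - A''. *)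
Definition potential_numerator : {poly K} :=
  a4 * a2 *+ 4 - a4 * a3^`() *+ 2 - a3 * (a3 - a4^`() *+ 2).

Local Notation N := potential_numerator.

(** With B = p N / (4 a4), this is 8 a4^2 / p times p a1 - B'. *)
Definition symmetry_defect : {poly K} :=
  a4 * a4 * a1 *+ 8 - a4 * N^`() *+ 2 - N * (a3 - a4^`() *+ 4).

Local Notation derivS :=
  (derivD, derivB, derivN, derivMn, derivM).

(** Two integrations by parts in int p L u, for u' = a4^2 t. The factor a4^2
    clears the denominators of A'' and B', so that each integration by parts
    subtracts a polynomial of the form [pearson]. *)
Lemma defect_from_operator (t : {poly K}) :
  let z := a4^`() * t *+ 2 + a4 * t^`() in
  operator_on_derivative (a4 * a4 * t) *+ 8
    - pearson a3 a4 ((a4 * a4 * t)^`()^`() *+ 4 + a3 * z *+ 2 + N * t)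
  = symmetry_defect * t.
Proof.
rewrite /= /operator_on_derivative /pearson /symmetry_defect /N !derivS.
ring.
Qed.

End Algebra.

(** For a4 = h X with X = x - c and u' = w = h^2 t, the boundary term A' w' + B w
    is e F / (4 X^2) up to sign, and its derivative is
    p (a3 w'' / 2 + a2 w' + a1 w) as soon as the defect vanishes. The factor h^2
    clears from the denominators all the roots of a4 other than c. *)
Lemma flux_identity {K : comNzRingType} (a1 a2 a3 h t X : {poly K}) :
  X^`() = 1 ->
  let a4 := h * X in
  let N := potential_numerator a2 a3 a4 in
  let y := h^`() * t *+ 2 + h * t^`() in
  let F := X * a3 * y *+ 2 + N * t in
  let w := h * h * t in
  a3 * F + X * h * F^`() *+ 2 - h * F *+ 4
    - X * X * (operator_on_derivative a1 a2 a3 a4 w *+ 4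
                - pearson a3 a4 (w^`()^`() *+ 2)) *+ 2
  = - (symmetry_defect a1 a2 a3 a4 * t).
Proof.
move=> dX; rewrite /= /operator_on_derivative /pearson.
rewrite /symmetry_defect /potential_numerator.
have d1 : (1 : {poly K})^`() = 0 by exact: derivC.
rewrite !(dX, d1, derivD, derivB, derivN, derivMn, derivM).
ring.
Qed.


(** * The leading coefficients at the ends *)

Section SelfAdjointWeight.
Context {R : realType}.
Variables (l r : \bar R) (p0 : R) (a1 a2 a3 a4 : {poly R}) (e p : R -> R) (s : R).
Local Notation I := (open_interval l r).
Local Notation endf := (end_filter l r).
Local Notation end_point := (end_point l r).
Local Notation L := (operator_on_derivative a1 a2 a3 a4).
Local Notation N := (potential_numerator a2 a3 a4).
Hypothesis Ip0 : I p0.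
Hypothesis W : pearson_weight l r a3 a4 e p s.
Hypothesis endpoints : forall b c, end_point b = c%:E -> root a4 c.
Hypothesis moment_L : forall w, moment l r p (L w) = 0.

#[local] Instance end_filter_proper_selfadjoint b : ProperFilter (endf b).
Proof. exact: end_filter_proper Ip0. Qed.

(** The moment of E t is 0 for every polynomial t, in particular for t = E. *)
Lemma symmetry_defect_eq0 : symmetry_defect a1 a2 a3 a4 = 0.
Proof.
set E := symmetry_defect _ _ _ _; apply: (moment_square_eq0 Ip0 W).
rewrite -defect_from_operator (momentB W) -scaler_nat (momentZ W) moment_L mulr0.
by rewrite (moment_pearson Ip0 W endpoints) subrr.
Qed.

Lemma defect_at_root c : root a4 c ->
  a3.[c] * (a3.[c] - a4^`().[c] *+ 2) * (a3.[c] - a4^`().[c] *+ 4) = 0.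
Proof.
move=> /rootP a4c; have := congr1 (horner^~ c) symmetry_defect_eq0.
rewrite /symmetry_defect /potential_numerator.
rewrite !(hornerD, hornerN, hornerM, hornerMn) a4c horner0 => E0.
by rewrite -[RHS]E0; ring.
Qed.

Lemma finite_end_neq b c x : end_point b = c%:E -> I x -> x - c != 0.
Proof.
rewrite subr_eq0; case: b => /= -> []; rewrite !lte_fin => lx xr.
- by rewrite lt_eqF.
- by rewrite gt_eqF.
Qed.

(** The logarithmic derivative of e / (x - c)^j is
    (a3 - 2 j h) / (2 a4) = u / (2 g), which has a limit at c. *)
Lemma ratio_flux_not_cvg0 b c (h g u D : {poly R}) (j : nat) :
  end_point b = c%:E ->
  a4 = h * ('X - c%:P) -> a4 = g * D -> a3 - h *+ (2 * j) = u * D ->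
  g.[c] != 0 ->
  ~ (fun x => e x / (x - c) ^+ j) @ endf b --> 0.
Proof.
move=> bc a4E a4E' a3E gc; pose q x := u.[x] / (2 * g.[x]).
have xc x : I x -> x - c != 0 by exact: finite_end_neq bc.
apply: (@log_derive_cvg_not_cvg0 _ l r p0 Ip0 b c
  (fun x => e x / (x - c) ^+ j) q (u.[c] / (2 * g.[c])) bc).
- move=> x Ix; have a4x := pw_neq0 W Ix; have x0 := xc x Ix.
  have hx : h.[x] != 0 by move: a4x; rewrite a4E hornerM mulf_eq0 negb_or => /andP[].
  have : g.[x] * D.[x] != 0 by rewrite -hornerM -a4E'.
  rewrite mulf_eq0 negb_or => /andP[gx Dx].
  have Xc := is_derive_subr c x.
  have Xj : (x - c) ^+ j != 0 by rewrite expf_neq0.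
  have dV := @is_deriveV _ (fun y => (y - c) ^+ j) x _ _ Xj (is_derive_exprn j Xc).
  apply: (is_derive_eq (is_derive_mul (pw_derive W Ix) dV)).
  have a4h : a4.[x] = h.[x] * (x - c) by rewrite a4E hornerM hornerXsubC.
  have gD : g.[x] * D.[x] = h.[x] * (x - c) by rewrite -a4h a4E' hornerM.
  have uD : u.[x] * D.[x] = a3.[x] - h.[x] *+ (2 * j).
    by rewrite -hornerM -a3E hornerD hornerN hornerMn.
  have -> : q x = (a3.[x] - h.[x] *+ (2 * j)) / (2 * (h.[x] * (x - c))).
    by rewrite /q -uD -gD; field; rewrite gx Dx.
  rewrite a4h /GRing.scale/=.
  case: j {a3E uD dV} Xj => [|j] Xj; first by field; rewrite hx x0.
  rewrite (exprS _ j) /= mulrnA -mulr_natr in Xj *.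
  have Xj' : (x - c) ^+ j != 0 by rewrite expf_neq0.
  move: ((x - c) ^+ j) Xj' => Y Y0.
  by field; rewrite hx x0.
- by move=> x Ix; rewrite mulf_neq0 ?invr_eq0 ?expf_neq0 ?xc// gt_eqF// (pw_e_gt0 W).
- apply: cvgM; first exact: (cvg_horner_finite_end Ip0 bc).
  apply: cvgV; first by rewrite mulf_neq0.
  apply: cvgMr; exact: (cvg_horner_finite_end Ip0 bc).
Qed.

Lemma cvg_inv_other_end b c : end_point b = c%:E ->
  exists K : R, (fun x => (x - c)^-1) @ endf (~~ b) --> K.
Proof.
move=> bc; case dE : (end_point (~~ b)) => [d||]; last 2 first.
- by exists 0; apply: (cvg_inv_infinite_end Ip0) => d; rewrite dE.
- by exists 0; apply: (cvg_inv_infinite_end Ip0) => d; rewrite dE.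
have dc : d - c != 0.
  rewrite subr_eq0; have [lp pr] := Ip0; have := lt_trans lp pr.
  case: (b) bc dE => /= -> ->; rewrite lte_fin => ?; last by rewrite gt_eqF.
  by rewrite lt_eqF.
exists (d - c)^-1; apply: cvgV => //; apply: cvgB; last exact: cvg_cst.
exact: (cvg_to_finite_end Ip0 dE).
Qed.

(** The integral over I of the derivative of this boundary term is 0, so the
    term has the same limit at both ends of I; at the end other than c it tends
    to 0 together with e F. *)
Lemma boundary_flux_cvg0 b c (h t : {poly R}) : end_point b = c%:E ->
  a4 = h * ('X - c%:P) ->
  (fun x => e x * (('X - c%:P) * a3 * (h^`() * t *+ 2 + h * t^`()) *+ 2 + N * t).[x]
            / (x - c) ^+ 2) @ endf b --> 0.
Proof.
move=> bc a4E.
pose F := ('X - c%:P) * a3 * (h^`() * t *+ 2 + h * t^`()) *+ 2 + N * t.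
pose w := h * h * t; pose G := L w *+ 4 - pearson a3 a4 (w^`()^`() *+ 2).
have FG : a3 * F + ('X - c%:P) * h * F^`() *+ 2 - h * F *+ 4
    = ('X - c%:P) * ('X - c%:P) * G *+ 2.
  apply/eqP; rewrite -subr_eq0; apply/eqP.
  have := flux_identity a1 a2 a3 h t (derivXsubC c).
  by rewrite /= -a4E symmetry_defect_eq0 mul0r oppr0 => <-.
have G0 : moment l r p (s *: G) = 0.
  rewrite (momentZ W) (momentB W) -scaler_nat (momentZ W) moment_L.
  by rewrite (moment_pearson Ip0 W endpoints) !mulr0 subrr mulr0.
clearbody G; pose f x := e x * F.[x] * (x - c)^-1 ^+ 2.
have f' x : I x -> is_derive x 1 f (p x * (s *: G).[x]).
  move=> Ix; have a4x := pw_neq0 W Ix; have x0 := finite_end_neq bc Ix.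
  have hx : h.[x] != 0 by move: a4x; rewrite a4E hornerM mulf_eq0 negb_or => /andP[].
  have Xc := is_derive_subr c x.
  have dV := is_derive_exprn 2 (@is_deriveV _ (fun y => y - c) x _ _ x0 Xc).
  apply: (is_derive_eq (is_derive_mul
    (is_derive_mul (pw_derive W Ix) (is_derive_poly F x)) dV)).
  have a4h : a4.[x] = h.[x] * (x - c) by rewrite a4E hornerM hornerXsubC.
  have FGx : a3.[x] * F.[x] + (x - c) * h.[x] * F^`().[x] *+ 2 - h.[x] * F.[x] *+ 4
      = (x - c) * (x - c) * G.[x] *+ 2.
    rewrite /f in dV *; clearbody F.
    have := congr1 (horner^~ x) FG; rewrite -(hornerXsubC c x).
    by rewrite !(hornerMn, hornerD, hornerN, hornerM).
  rewrite hornerZ (factorE W Ix) a4h /GRing.scale /=.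
  have -> : G.[x] =
    (a3.[x] * F.[x] + (x - c) * h.[x] * F^`().[x] *+ 2 - h.[x] * F.[x] *+ 4)
     / ((x - c) * (x - c) *+ 2).
    by rewrite FGx; field.
  by field; rewrite hx x0.
have [lim [flim]] := integrable_derive_end_limits f'
  (fun x Ix => weight_poly_continuous W (w := s *: G) Ix) (pw_integrable W (s *: G)) Ip0.
rewrite -/(moment l r p (s *: G)) G0 => limE.
have lim0 : lim (~~ b) = 0.
  have [K invK] := cvg_inv_other_end bc.
  have f0 : f @ endf (~~ b) --> 0 * K ^+ 2.
    apply: cvgM; first exact: (flux_cvg0 Ip0 W endpoints).
    rewrite expr2; under eq_fun do rewrite expr2.
    exact: cvgM.
  by rewrite mul0r in f0; exact: cvg_unique (flim (~~ b)) f0.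
have limb : lim b = 0.
  move/esym/eqP: limE; rewrite subr_eq0 => /eqP limE.
  by case: (b) lim0 => /= <-.
have := flim b; rewrite limb; apply: cvg_eq_near.
by near=> x; rewrite /f exprVn.
Unshelve. all: by end_near. Qed.

Lemma cvg0_of_mul_poly b c (f : R -> R) (S : {poly R}) : end_point b = c%:E ->
  S.[c] != 0 -> (fun x => f x * S.[x]) @ endf b --> 0 -> f @ endf b --> 0.
Proof.
move=> bc Sc fS; have Scvg := cvg_horner_finite_end (v := S) Ip0 bc.
have fSV : (fun x => f x * S.[x] * S.[x]^-1) @ endf b --> 0 * S.[c]^-1.
  by apply: cvgM fS _; exact: cvgV.
rewrite mul0r in fSV; apply: cvg_eq_near fSV.
have Sn0 : \forall x \near endf b, S.[x] != 0 by exact: cvgr_neq0 Scvg Sc.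
by near=> x; rewrite mulfK//; near: x.
Unshelve. all: by end_near. Qed.

(** Were c a simple root, e / (x - c)^j would tend to 0 for the j such that
    a3(c) = 2 j h(c). The boundary term with t = x - c gives it for j = 1, and the
    one with t = 1 for j = 2. *)
Lemma finite_end_double_root b c : end_point b = c%:E ->
  exists g, a4 = g * ('X - c%:P) ^+ 2.
Proof.
move=> bc; have /factor_theorem[h a4E] := endpoints bc.
have [/factor_theorem[g hE]|hc] := boolP (root h c).
  by exists g; rewrite a4E hE expr2 mulrA.
exfalso; rewrite rootE in hc.
have dc : a4^`().[c] = h.[c].
  by rewrite a4E derivM derivXsubC hornerD !hornerM hornerXsubC hornerC subrr mulr0 add0r mulr1.
have no_limit j : root (a3 - h *+ (2 * j)) c ->
    (fun x => e x / (x - c) ^+ j) @ endf b --> 0 -> False.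
  move=> /factor_theorem[u a3E].
  exact: (ratio_flux_not_cvg0 bc a4E a4E a3E hc).
have := defect_at_root (endpoints bc); rewrite dc => /eqP.
have Nc : N.[c] = - (a3.[c] * (a3.[c] - h.[c] *+ 2)).
  rewrite /potential_numerator !(hornerD, hornerN, hornerM, hornerMn) dc.
  by rewrite (rootP (endpoints bc)); ring.
rewrite !mulf_eq0 => /orP[/orP[a3c|a3c]|a3c].
- apply: (no_limit 0); first by rewrite muln0 mulr0n subr0.
  apply: cvg_eq_near (finite_end_factor_cvg0 Ip0 W endpoints bc).
  by near=> x; rewrite expr0 divr1.
- apply: (no_limit 1%N); first by rewrite rootE hornerD hornerN hornerMn.
  pose S := a3 * (h^`() * ('X - c%:P) *+ 2 + h) *+ 2 + N.
  have Sc : S.[c] != 0.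
    rewrite /S 2!(hornerMn, hornerD) hornerM 1!(hornerMn, hornerD) hornerMn hornerM.
    rewrite hornerXsubC subrr mulr0 mul0rn add0r Nc (eqP a3c) mulr0 oppr0 addr0.
    have -> : a3.[c] = h.[c] *+ 2 by apply/eqP; rewrite -subr_eq0.
    by rewrite mulrn_eq0 mulf_eq0 mulrn_eq0 /= (negbTE hc).
  apply: (cvg0_of_mul_poly bc Sc).
  have := boundary_flux_cvg0 ('X - c%:P) bc a4E.
  have -> : ('X - c%:P) * a3 * (h^`() * ('X - c%:P) *+ 2 + h * ('X - c%:P)^`()) *+ 2
      + N * ('X - c%:P) = ('X - c%:P) * S.
    by rewrite derivXsubC /S; ring.
  apply: cvg_eq_near; near=> x.
  have Ix : I x by near: x; exact: end_filter_near_interval Ip0 b.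
  have x0 := finite_end_neq bc Ix.
  by rewrite hornerM hornerXsubC; move: (S.[x]) => y; field.
- apply: (no_limit 2%N); first by rewrite rootE hornerD hornerN hornerMn.
  have := boundary_flux_cvg0 1 bc a4E; set F := _ + _ * 1 => F0.
  have Fc : F.[c] != 0.
    rewrite /F hornerD hornerMn !hornerM hornerXsubC subrr !mul0r mul0rn add0r.
    rewrite hornerC mulr1 Nc.
    have -> : a3.[c] = h.[c] *+ 4 by apply/eqP; rewrite -subr_eq0.
    have -> : h.[c] *+ 4 - h.[c] *+ 2 = h.[c] *+ 2 by ring.
    by rewrite oppr_eq0 mulf_eq0 !mulrn_eq0 /= (negbTE hc).
  apply: (cvg0_of_mul_poly bc Fc); apply: cvg_eq_near F0; near=> x.
  by rewrite mulrAC.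
Unshelve. all: by end_near. Qed.

(** If (x - c)^2 divided a3, then a3 / a4 would be regular at c and e would not
    tend to 0 there. *)
Lemma finite_end_a3_simple_root b c (g : {poly R}) : end_point b = c%:E ->
  a4 = g * ('X - c%:P) ^+ 2 -> g.[c] != 0 -> mup c a3 = 1%N.
Proof.
move=> bc a4E gc; set X := 'X - c%:P in a4E.
have Xc : X.[c] = 0 by rewrite hornerXsubC subrr.
have a4E' : a4 = (g * X) * X by rewrite a4E expr2 mulrA.
have root_a3 : root a3 c.
  have dc : a4^`().[c] = 0.
    by rewrite a4E' derivM hornerD !hornerM Xc !mulr0 mul0r addr0.
  have := defect_at_root (endpoints bc).
  by rewrite dc !mul0rn !subr0 => /eqP; rewrite !mulf_eq0 !orbb.
have not_double : ~~ (X ^+ 2 %| a3).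
  apply/negP => /dvdpP[u a3E].
  apply: (@ratio_flux_not_cvg0 b c (g * X) g u (X ^+ 2) 0) => //.
  - by rewrite muln0 mulr0n subr0.
  - apply: cvg_eq_near (finite_end_factor_cvg0 Ip0 W endpoints bc).
    by near=> x; rewrite expr0 divr1.
have a3n0 : a3 != 0 by apply: contraNneq not_double => ->; rewrite dvdp0.
apply/eqP; rewrite eqn_leq -ltnS mup_ltn// not_double mup_geq// expr1.
by rewrite dvdp_XsubCl.
Unshelve. all: by end_near. Qed.

(** Otherwise x e' / e = x a3 / (2 a4) would have a limit at the infinite end. *)
Lemma infinite_end_size b n : (forall c, end_point b <> c%:E) ->
  size a4 = n.+1 -> (n < size a3)%N.
Proof.
move=> binf a4n; rewrite ltnNge; apply/negP => a3n.
have lc : a4`_n != 0 by rewrite -[n]/n.+1.-1 -a4n -lead_coefE lead_coef_eq0 -size_poly_eq0 a4n.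
pose q x := a3.[x] / (2 * a4.[x]).
have xq : (fun x => x * q x) @ endf b --> (a3 * 'X)`_n / (2 * a4`_n).
  have num := @cvg_coef_infinite_end _ l r p0 Ip0 b (a3 * 'X) n binf.
  have den := @cvg_coef_infinite_end _ l r p0 Ip0 b a4 n binf.
  have lim : (fun x => (a3 * 'X).[x] / x ^+ n / (2 * (a4.[x] / x ^+ n))) @ endf b
      --> (a3 * 'X)`_n / (2 * a4`_n).
    apply: cvgM.
      apply: num; have [->|a30] := eqVneq a3 0; first by rewrite mul0r size_poly0.
      by rewrite size_mulX.
    apply: cvgV; first by rewrite mulf_neq0.
    by apply: cvgMr; apply: den; rewrite a4n.
  apply: cvg_eq_near lim; have xfar := near_infinite_end Ip0 1 binf; near=> x.
  have Ix : I x by near: x; exact: end_filter_near_interval Ip0 b.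
  have x1 : 1 < (-1) ^+ (~~ b) * x by near: x.
  have xn0 : x != 0 by apply: contraTneq x1 => ->; rewrite mulr0 ltr10.
  have a4x := pw_neq0 W Ix; have xn : x ^+ n != 0 by rewrite expf_neq0.
  rewrite /q hornerM hornerX; move: (x ^+ n) xn => Y Y0.
  by field; rewrite a4x Y0.
have e0 x : I x -> e x != 0 by move=> Ix; rewrite gt_eqF// (pw_e_gt0 W).
have [v] := power_decay_infinite_end Ip0 binf (pw_derive W) e0 xq.
by apply; exact: (flux_cvg0 Ip0 W endpoints).
Unshelve. all: by end_near. Qed.

Hypothesis size_a1 : (size a1 <= 2)%N.
Hypothesis size_a2 : (size a2 <= 3)%N.
Hypothesis size_a3 : (size a3 <= 4)%N.

(** In E = 0 the product N a3 would have degree 9, since N = - a3^2 + lower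
    terms, while the other terms have degree at most 8. *)
Lemma size_a3a4_not4 : size a3 = 4%N -> size a4 = 4%N -> False.
Proof.
move=> s3 s4.
have mle (u v : {poly R}) i j : (size u <= i)%N -> (size v <= j)%N ->
    (size (u * v)%R <= (i + j).-1)%N.
  move=> ui vj; apply: leq_trans (size_polyMleq _ _) _.
  by rewrite -!subn1 leq_sub2r// leq_add.
have nle (u : {poly R}) i k : (size u <= i)%N -> (size (u *+ k)%R <= i)%N.
  by move=> ui; rewrite -scaler_nat; exact: leq_trans (size_scale_leq _ _) ui.
have dle (u : {poly R}) i : (size u <= i.+1)%N -> (size u^`() <= i)%N.
  move=> ui; have [->|u0] := eqVneq u 0; first by rewrite deriv0 size_poly0.
  by rewrite -ltnS; exact: leq_trans (lt_size_deriv u0) ui.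
have Dle (u v : {poly R}) i :
    (size u <= i)%N -> (size v <= i)%N -> (size (u + v)%R <= i)%N.
  by move=> ui vi; apply: leq_trans (size_polyD _ _) _; rewrite geq_max ui.
have Nle (u : {poly R}) i : (size u <= i)%N -> (size (- u)%R <= i)%N by rewrite size_polyN.
have a4le : (size a4 <= 4)%N by rewrite s4.
have a30 : a3 != 0 by rewrite -size_poly_eq0 s3.
have NE : N = - (a3 * a3) + (a4 * a2 *+ 4 - a4 * a3^`() *+ 2 + a3 * a4^`() *+ 2).
  by rewrite /potential_numerator; ring.
have sN : size N = 7%N.
  rewrite NE size_polyDl size_polyN size_mul// s3//.
  rewrite ltnS; apply: (Dle _ _ 6); first apply: (Dle _ _ 6).
  - exact/nle/(mle _ _ 4 3).
  - exact/Nle/nle/(mle _ _ 4 3)/dle.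
  - exact/nle/(mle _ _ 4 3)/dle.
have N0 : N != 0 by rewrite -size_poly_eq0 sN.
have : size (N * a3) = 10%N by rewrite size_mul// sN s3.
have -> : N * a3 = a4 * a4 * a1 *+ 8 - a4 * N^`() *+ 2 + N * a4^`() *+ 4.
  apply/eqP; rewrite -subr_eq0 -oppr_eq0 -[X in _ == X]symmetry_defect_eq0 /symmetry_defect.
  by apply/eqP; ring.
move=> s10; suff : (10 <= 9)%N by [].
rewrite -[X in (X <= _)%N]s10.
apply: (Dle _ _ 9); first apply: (Dle _ _ 9).
- apply: nle; apply: (@leq_trans 8) => //; apply: (mle _ _ 7 2) => //.
  exact: (mle _ _ 4 4).
- apply/Nle/nle/(mle _ _ 4 6) => //; apply: dle; by rewrite sN.
- apply/nle/(mle _ _ 7 3); [by rewrite sN|exact: dle].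
Qed.

Lemma all_ends_finite b : (4 <= size a4)%N -> exists c, end_point b = c%:E.
Proof.
move=> s4; apply: contrapT => /forallNP binf.
have s4E : size a4 = (size a4).-1.+1 by rewrite prednK//; exact: leq_trans s4.
have := infinite_end_size binf s4E.
have [s45|s45] := leqP (size a4) 4.
  have a44 : size a4 = 4%N by apply/eqP; rewrite eqn_leq s45.
  rewrite a44 => s3; apply: size_a3a4_not4 a44.
  by apply/eqP; rewrite eqn_leq size_a3.
move=> s3; have := leq_trans s3 size_a3; rewrite leqNgt.
by rewrite -ltnS -s4E ltnS in s45 *; rewrite s45.
Qed.

End SelfAdjointWeight.


(** * From the operator to its moments *)

Section WeightOfOperator.
Context {R : realType}.
Variables (l r : \bar R) (p0 : R) (a1 a2 a3 a4 : {poly R}).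
Local Notation I := (open_interval l r).
Local Notation mu := (@lebesgue_measure R).
Hypothesis Ip0 : I p0.
Hypothesis a4_noroot : forall x, I x -> ~~ root a4 x.

Lemma no_root_same_sign x : I x -> 0 < a4.[p0] * a4.[x].
Proof.
move=> Ix; rewrite ltNge; apply/negP => Px.
pose P := a4.[p0] *: a4.
have P0 : 0 <= P.[p0] by rewrite hornerZ -expr2 sqr_ge0.
have {}Px : P.[x] <= 0 by rewrite hornerZ.
have noroot z : I z -> ~~ root P z.
  by move=> Iz; rewrite /P rootZ a4_noroot.
have [p0x|xp0] := leP p0 x.
- have [|z p0zx] := @poly_ivt _ (- P) p0 x p0x.
    by rewrite !hornerN oppr_le0 P0 oppr_ge0.
  rewrite rootN => rz.
  by have := noroot z (open_interval_between Ip0 Ix p0zx); rewrite rz.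
- have [|z p0zx rz] := @poly_ivt _ P x p0 (ltW xp0); first by rewrite Px.
  by have := noroot z (open_interval_between Ix Ip0 p0zx); rewrite rz.
Qed.

Local Notation p := (weight a3 a4 p0).
Let e x := expR (2^-1 * oriented_integral p0 x (fun t => a3.[t] / a4.[t])).

Let a4_neq0 x : I x -> a4.[x] != 0.
Proof. by move=> /a4_noroot; rewrite rootE. Qed.

Let e' x : I x -> is_derive x 1 e (e x * (a3.[x] / (2 * a4.[x]))).
Proof.
move=> Ix.
have Gx : is_derive x 1 (fun y => oriented_integral p0 y (fun t => a3.[t] / a4.[t]))
    (a3.[x] / a4.[x]).
  apply: (@is_derive_oriented_integral _ _ _ (fun t => a3.[t] / a4.[t]) _ _ Ip0 Ix).
  move=> y Iy.
  apply: cvgM; first exact: continuous_horner.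
  apply: cvgV; [exact: a4_neq0|exact: continuous_horner].
apply: is_derive_eq; rewrite /GRing.scale/= /e.
by have := a4_neq0 Ix => a4x; field.
Qed.

Hypothesis p_adm : admissible I p.

Let pw_int (w : {poly R}) : mu.-integrable I (EFin \o (fun x => p x * w.[x])).
Proof.
apply/integrableP; split.
  apply/measurable_EFinP; apply: open_interval_measurable_fun => x Ix.
  apply: cvgM; last exact: continuous_horner.
  apply: cvgM; last exact: (is_derive_continuous (e' Ix)).
  apply: cvgV; first by rewrite normr_eq0 a4_neq0.
  by apply: cvg_norm; exact: continuous_horner.
apply: le_lt_trans (p_adm w).
rewrite le_eqVlt; apply/orP; left; apply/eqP; apply: eq_integral => x _ /=.
by rewrite normrM ger0_norm// mulr_ge0 ?invr_ge0// expR_ge0.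
Qed.

Lemma weight_pearson : exists s, pearson_weight l r a3 a4 e p s.
Proof.
exists (Num.sg a4.[p0]); split => //.
- by move=> x _; exact: expR_gt0.
- by rewrite -expr2 sqr_sg a4_neq0.
- move=> x /no_root_same_sign; have [a40|a40|<-] := ltgtP 0 a4.[p0].
  + by rewrite pmulr_rgt0// => a4x; rewrite gtr0_sg// mul1r gtr0_norm.
  + by rewrite nmulr_rgt0// => a4x; rewrite ltr0_sg// mulN1r ltr0_norm.
  + by rewrite mul0r ltxx.
- by move=> x Ix; rewrite /weight mulrC.
Qed.

Lemma derive1n_horner n (u : {poly R}) :
  derive1n n (horner u) = horner (u^`(n)).
Proof. by elim: n => [//|n IH]; rewrite derive1nS IH derivnS derivE. Qed.

Lemma smooth_poly_bounded_horner (u : {poly R}) :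
  smooth_poly_bounded I (horner u).
Proof.
move=> n; rewrite derive1n_horner; split=> [x _|]; first exact: derivable_horner.
set v := u^`(n); exists (v ^+ 2 + 1) => x _.
rewrite hornerD hornerC expr2 hornerM.
by rewrite ler_norml; apply/andP; split; nra.
Qed.

Lemma antiderivative_poly (w : {poly R}) : exists u : {poly R}, u^`() = w.
Proof.
exists (\poly_(i < (size w).+1) (w`_i.-1 / i%:R)).
apply/polyP => i; rewrite coef_deriv coef_poly ltnS.
case: ltnP => [_|wi] /=; last by rewrite mul0rn nth_default.
by rewrite -[LHS]mulr_natr divfK// pnatr_eq0.
Qed.

Hypothesis L_sa : self_adjoint I p (diff_op a1 a2 a3 a4).

(** Self-adjointness tested on y = 1, for which L y = 0. *)
Lemma moment_operator_on_derivative w :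
  moment l r p (operator_on_derivative a1 a2 a3 a4 w) = 0.
Proof.
have [u uw] := antiderivative_poly w.
have := L_sa (smooth_poly_bounded_horner 1) (smooth_poly_bounded_horner u).
rewrite (_ : (fun x => _) = cst 0%E); last first.
  apply/funext => x; rewrite /diff_op !derive1n_horner.
  by rewrite -(polyC1 R) !derivnC !horner0 !mulr0 !addr0 mulr0 mul0r.
rewrite integral0 => /esym eq0; rewrite /moment /Rintegral.
rewrite [X in fine X](_ : _ = 0%E)// -[RHS]eq0; apply: eq_integral => x _.
rewrite /diff_op !derive1n_horner hornerC mulr1 -uw /operator_on_derivative.
by rewrite !(hornerD, hornerM).
Qed.

End WeightOfOperator.


(** * The two double roots *)

Lemma double_roots_quartic {K : fieldType} (f : {poly K}) (c d : K) :
  f != 0 -> (size f <= 5)%N -> c != d ->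
  ('X - c%:P) ^+ 2 %| f -> ('X - d%:P) ^+ 2 %| f ->
  exists2 k, k != 0 & f = k *: (('X - c%:P) ^+ 2 * ('X - d%:P) ^+ 2).
Proof.
move=> f0 sf cd cf df.
have : ('X - c%:P) ^+ 2 * ('X - d%:P) ^+ 2 %| f.
  rewrite Gauss_dvdp ?cf ?df// coprimep_expl// coprimep_expr//.
  by rewrite coprimep_XsubC2// subr_eq0 eq_sym.
move=> /dvdpP[g fE]; have g0 : g != 0 by apply: contraNneq f0 => g0; rewrite fE g0 mul0r.
have /size_poly1P[k k0 gE] : size g == 1%N.
  rewrite eqn_leq size_poly_gt0 g0 andbT.
  move: sf; rewrite fE !size_mul ?mulf_neq0 ?expf_neq0 ?polyXsubC_eq0//.
  by rewrite !size_XsubC /= addnS /= addn4 ltnS.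
by exists k => //; rewrite fE gE mul_polyC.
Qed.

Theorem corollary3p5 (R : realType) (a1 a2 a3 a4 : {poly R})
    (l r : \bar R) (p0 : R)
    (deg_a1 : (size a1 <= 2)%N) (deg_a2 : (size a2 <= 3)%N)
    (deg_a3 : (size a3 <= 4)%N) (deg_a4 : (size a4 <= 5)%N)
    (a4_neq0 : a4 != 0)
    (I_zeros : consecutive_zeros a4 l r)
    (p0_in_I : open_interval l r p0)
    (p_adm : admissible (open_interval l r) (weight a3 a4 p0))
    (L_sa : self_adjoint (open_interval l r) (weight a3 a4 p0)
              (diff_op a1 a2 a3 a4))
    (two_roots : exists x y : R, [/\ x != y, root a4 x & root a4 y]) :
  (exists x y : R,
      [/\ x != y,
          (forall z : R, root a4 z <-> z = x \/ z = y),
          mup x a4 = 2%N & mup y a4 = 2%N]) /\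
  (forall x : R, root a4 x -> mup x a3 = 1%N).
Proof.
have [lr endl endr noroot] := I_zeros.
have [s W] := weight_pearson p0_in_I noroot p_adm.
have moment_L := moment_operator_on_derivative L_sa.
have endpoints b c : end_point l r b = c%:E -> root a4 c.
  by case: b => /= ec; [exact: endr|exact: endl].
have double b c : end_point l r b = c%:E -> ('X - c%:P) ^+ 2 %| a4.
  move=> bc; have [g ->] := finite_end_double_root p0_in_I W endpoints moment_L bc.
  exact: dvdp_mull.
have [x [y [xy rx ry]]] := two_roots.
have [b [c bc]] : exists b c, end_point l r b = c%:E.
  apply: contrapT => nofin.
  suff Ix : open_interval l r x by have := noroot x Ix; rewrite rx.
  have [lp pr] := p0_in_I; split.
  - case lE : l lp nofin => [e|//|] _ nofin; last exact: ltNyr.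
    by case: nofin; exists false, e.
  - case rE : r pr nofin => [e||//] _ nofin; last exact: ltry.
    by case: nofin; exists true, e.
have c_root := endpoints b c bc.
have [d dc rd] : exists2 d, d != c & root a4 d.
  have [xc|] := eqVneq x c; last by exists x.
  by exists y => //; rewrite -xc eq_sym.
have size_a4 : (4 <= size a4)%N.
  have : ('X - c%:P) ^+ 2 * ('X - d%:P) %| a4.
    rewrite Gauss_dvdp; first by rewrite (double _ _ bc) dvdp_XsubCl.
    by rewrite coprimep_expl// coprimep_XsubC2// subr_eq0.
  move=> /dvdp_leq - /(_ a4_neq0).
  by rewrite size_mul ?expf_neq0 ?polyXsubC_eq0// size_XsubC size_exp_XsubC.
have finite b' : exists c, end_point l r b' = c%:E.
  exact: (all_ends_finite p0_in_I W endpoints moment_L deg_a1 deg_a2 deg_a3 b' size_a4).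
have [c1 e1] := finite false; have [c2 e2] := finite true.
have c12 : c1 != c2.
  by move: lr; rewrite (e1 : l = _) (e2 : r = _) lte_fin => /lt_eqF ->.
have [k k0 a4E] := double_roots_quartic a4_neq0 deg_a4 c12 (double _ _ e1)
  (double _ _ e2).
have rootE' z : root a4 z <-> z = c1 \/ z = c2.
  rewrite a4E rootZ// rootM !root_exp_XsubC//.
  split=> [/orP[/eqP|/eqP]|[->|->]]; [by left|by right|by rewrite eqxx|by rewrite eqxx orbT].
have simple1 : mup c1 a3 = 1%N.
  apply: (@finite_end_a3_simple_root _ l r p0 a1 a2 a3 a4 _ _ s p0_in_I W endpoints
     moment_L
     false c1 (k *: ('X - c2%:P) ^+ 2)) => //.
  - by rewrite a4E -scalerAl [X in k *: X]mulrC.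
  - by rewrite hornerZ horner_exp hornerXsubC mulf_neq0// expf_neq0// subr_eq0.
have simple2 : mup c2 a3 = 1%N.
  apply: (@finite_end_a3_simple_root _ l r p0 a1 a2 a3 a4 _ _ s p0_in_I W endpoints
     moment_L
     true c2 (k *: ('X - c1%:P) ^+ 2)) => //.
  - by rewrite a4E -scalerAl.
  - by rewrite hornerZ horner_exp hornerXsubC mulf_neq0// expf_neq0// subr_eq0 eq_sym.
split; last by move=> z /rootE'[->|->].
exists c1, c2; split => //.
- rewrite a4E -mul_polyC mupMr ?rootC// mupMl.
    by rewrite mup_XsubCX eqxx.
  by rewrite root_exp_XsubC.
- rewrite a4E -mul_polyC mupMr ?rootC// mupMr.
    by rewrite mup_XsubCX eqxx.
  by rewrite root_exp_XsubC// eq_sym.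
Qed.
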